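(* Let $n\ge 0$ be an integer and let $\mathbf E=[E_0,E_1,\ldots,E_n]$ be a family of polynomials $E_j(t)\in\mathbb{C}[t]$ such that $E_j$ has degree at most $j$ for each $j$. Write $E_j(t)=\frac{t^j}{j!}v_j+(\text{terms of degree}<j)$ with $v_j\in\mathbb{C}$, and put $$c(\mathbf E)=\sum_{p=0}^n(-1)^{n-p}(p+1)v_p .$$ For $0\le p\le n$ define $F_p(t)=\sum_{j=0}^p(-1)^j\binom{n-j}{n-p}E_j(t)$. If $n$ is odd and $m=(n+1)/2$, then $$c(\mathbf E)=\sum_{p=m}^n\sum_{i=1}^{p+1-m}(-1)^{p+m-i}\binom{p+1}{m+i}\, i\,\big(E_p(-i)+F_p(i)\big).$$ If $n$ is even and $m=n/2$, then $$c(\mathbf E)=\sum_{p=m}^n\sum_{i=1}^{p+1-m}(-1)^{p+1+m-i}\left(\binom{p+1}{m+i}-\binom{p+1}{m+i+1}\right)\frac{i}{2}\,\big(E_p(-i)+F_p(i)\big).$$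
   Context: $\binom{a}{b}=0$ when $b>a\ge 0$. *)

(* Defs.v *)
From HB Require Import structures.
From mathcomp Require Import all_boot all_order all_algebra.
From mathcomp Require Import complex.
From mathcomp Require Import reals.

Set Implicit Arguments.
Unset Strict Implicit.
Unset Printing Implicit Defensive.

Import GRing.Theory.
Local Open Scope ring_scope.

Section Family.
Variables (R : realType) (n : nat).

(* [c(E)], as a function of the normalised leading coefficients
   [v_0, ..., v_n] of the family [E]. *)
Definition cE (v : 'I_n.+1 -> R[i]) : R[i] :=
  \sum_(p < n.+1) (-1) ^+ (n - p) * p.+1%:R * v p.

Definition F (E : 'I_n.+1 -> {poly R[i]}) (p : 'I_n.+1) : {poly R[i]} :=
  \sum_(j < n.+1 | (j <= p)%N) ((-1) ^+ j * 'C(n - j, n - p)%:R) *: E j.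

End Family.

(* Main.v *)
(* Collect the terms of the double sum by the polynomial [E_j] they involve.
   An alternating Vandermonde-type identity evaluates the coefficient of
   [E_j(i)] arising from the [F_p], and the result is, up to [i -> -i], the same
   expression as the coefficient of [E_j(-i)]. For odd [n] the two halves
   therefore glue to one sum over the integers,
     [(-1)^j \sum_k (-1)^k C(j+1, k) (k - m) E_j(m - k)],
   a full [(j+1)]-th difference of a polynomial of degree at most [j+1], which
   only sees its leading coefficient. For even [n] the difference of binomials
   splits the sum into two, whose halves glue crosswise with [m] and [m + 1]
   in the role of [m]. *)
Require Import Defs.
From HB Require Import structures.
From mathcomp Require Import all_boot all_order all_algebra.
From mathcomp Require Import complex.
From mathcomp Require Import reals.
From mathcomp Require Import ring zify.

Set Implicit Arguments.
Unset Strict Implicit.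
Unset Printing Implicit Defensive.

Import GRing.Theory.
Local Open Scope ring_scope.

(** * Alternating binomial sums as iterated differences *)

(** Pascal's rule: an iterated difference is the lower-order difference of the first difference. *)
Lemma alternating_bin_recl (K : comNzRingType) (N : nat) (h : nat -> K) :
  \sum_(k < N.+2) (-1) ^+ k * 'C(N.+1, k)%:R * h k =
  \sum_(k < N.+1) (-1) ^+ k * 'C(N, k)%:R * (h k - h k.+1).
Proof.
rewrite big_ord_recl [RHS](eq_bigr (fun k : 'I_N.+1 =>
  (-1) ^+ k * 'C(N, k)%:R * h k - (-1) ^+ k * 'C(N, k)%:R * h k.+1)); last first.
  by move=> k _; rewrite mulrBr.
rewrite sumrB [X in _ = X - _]big_ord_recl !bin0 -addrA; congr (_ + _).
have -> : \sum_(i < N) (-1) ^+ lift ord0 i * 'C(N, lift ord0 i)%:R * h (lift ord0 i)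
   = \sum_(i < N.+1) (-1) ^+ i.+1 * 'C(N, i.+1)%:R * h i.+1 :> K.
  by rewrite big_ord_recr /= bin_small // mulr0 mul0r addr0.
rewrite -sumrB; apply: eq_bigr => i _.
by rewrite lift0 binS natrD exprS; ring.
Qed.

(** Induction by dividing out the last node [c = a - N.+1]: the constant [q.[c]] has zero
    difference, and the factor [N.+1 - k] turns ['C(N.+1, k)] into [N.+1] times ['C(N, k)]. *)
Lemma alternating_bin_horner (K : comNzRingType) (N : nat) (a : K)
    (q : {poly K}) :
  (size q <= N.+1)%N ->
  \sum_(k < N.+1) (-1) ^+ k * 'C(N, k)%:R * q.[a - k%:R] = N`!%:R * q`_N.
Proof.
elim: N q => [|N IHN] q sq.
  rewrite big_ord_recl big_ord0 bin0 (size1_polyC sq) hornerC coefC /=.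
  by rewrite fact0; ring.
pose c := a - N.+1%:R.
have /factor_theorem [q1 q1E] : root (q - q.[c]%:P) c.
  by rewrite /root hornerD hornerN hornerC subrr.
have qE : q = q1 * ('X - c%:P) + q.[c]%:P by rewrite -q1E subrK.
have sq1 : (size q1 <= N.+1)%N.
  have [->|q1_neq0] := eqVneq q1 0; first by rewrite size_poly0.
  have : (size (q - q.[c]%:P)%R <= N.+2)%N.
    rewrite (leq_trans (size_polyD _ _)) // geq_max sq size_polyN.
    by rewrite (leq_trans (size_polyC_leq1 _)).
  by rewrite q1E size_Mmonic ?monicXsubC // size_XsubC addn2.
have -> : q`_N.+1 = q1`_N.
  rewrite qE coefD coefC /= addr0 mulrBr coefB coefMX coefMC /=.
  by rewrite [q1`_N.+1]nth_default // mul0r subr0.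
rewrite (eq_bigr (fun k : 'I_N.+2 => (-1) ^+ k * 'C(N.+1, k)%:R *
    (q1.[a - k%:R] * (N.+1%:R - k%:R)) +
    (-1) ^+ k * 'C(N.+1, k)%:R * q.[c])); last first.
  move=> k _; rewrite -mulrDr; congr (_ * _).
  by rewrite {1}qE hornerD hornerM hornerXsubC hornerC /c; ring.
rewrite big_split /= [X in _ + X](alternating_bin_recl _ (fun=> q.[c])).
rewrite [X in _ + X]big1 ?addr0 => [|k _]; last by rewrite subrr mulr0.
rewrite big_ord_recr /= subrr !mulr0 addr0 factS natrM -mulrA -IHN //.
rewrite mulr_sumr; apply: eq_bigr => k _.
have /(congr1 (fun x => x%:R : K)) := mul_bin_down N.+1 k.
rewrite !natrM natrB /= => [binE|]; last by rewrite ltnW // ltnS ltnW.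
transitivity ((-1) ^+ k * q1.[a - k%:R] * ((N.+1%:R - k%:R) * 'C(N.+1, k)%:R)).
  by ring.
by rewrite -binE; ring.
Qed.

(** The usual value has ['C(M, c - N)]. Its mirror image ['C(M, M + N - c)] vanishes by itself for
    [c < N]; the guard excludes [c > M + N], where truncated subtraction would give [1]. *)
Lemma alternating_bin_bin (K : comNzRingType) (N M c : nat) :
  \sum_(k < N.+1) (-1) ^+ k * 'C(N, k)%:R * 'C(M + k, c)%:R =
  if (c <= M + N)%N then (-1) ^+ N * 'C(M, M + N - c)%:R else 0 :> K.
Proof.
elim: N M => [|N IHN] M.
  rewrite big_ord_recl big_ord0 !addn0 !mul1r addr0.
  by case: leqP => [/bin_sub -> //|/bin_small ->].
rewrite (alternating_bin_recl _ (fun k => 'C(M + k, c)%:R)).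
under eq_bigr do rewrite mulrBr addnS -addSn.
rewrite sumrB !IHN addSn addnS.
case: (leqP c (M + N)) => [le_c|lt_c].
  rewrite leqW // subSn // binS natrD exprS; ring.
case: leqP => [le_c|_]; last by rewrite subr0.
(* Boundary case: only the sum with [M.+1] survives. *)
have -> : c = (M + N).+1 by lia.
by rewrite subnn !bin0 exprS; ring.
Qed.

(** * Reindexing, and the weights of [E j] inside the [F] terms *)

Lemma sum_ord_shift (V : nmodType) (f : nat -> V) (L a B : nat) :
  (L <= a + B)%N -> (forall k, (L <= k < a + B)%N -> f k = 0) ->
  \sum_(i < B) f (a + i)%N = \sum_(k < L | (a <= k)%N) f k.
Proof.
move=> le_L f0; rewrite (big_ord_widen_cond _ (leq a) f le_L) big_mkcondr.
rewrite big_split_ord /= [X in _ = X + _]big1 ?add0r => [|k]; last by rewrite leqNgt ltn_ord.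
rewrite [RHS](eq_bigl xpredT) => [|i]; last by rewrite leq_addr.
apply: eq_bigr => i _; case: ltnP => // le_k.
by rewrite f0 // le_k ltn_add2l ltn_ord.
Qed.

Lemma sum_ord_reflect (V : nmodType) (f : nat -> V) (L b B : nat) :
  (b < B)%N -> (forall k, (L <= k)%N -> f k = 0) ->
  \sum_(i < B) (if (i <= b)%N then f (b - i)%N else 0) =
  \sum_(k < L | (k <= b)%N) f k.
Proof.
move=> lt_b f0.
rewrite -(big_mkcond (fun i : 'I_B => (i <= b)%N) (fun i : 'I_B => f (b - i)%N)).
rewrite -(big_ord_widen B (fun i => f (b - i)%N) lt_b).
rewrite (reindex_inj rev_ord_inj) /=.
rewrite (eq_bigr (fun i : 'I_b.+1 => f i)) => [|i _]; last first.
  by rewrite subSS subKn // -ltnS ltn_ord.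
rewrite (big_ord_widen (maxn b.+1 L) f (leq_maxl _ _)).
rewrite (big_ord_widen_cond (maxn b.+1 L) (fun k => k <= b)%N f (leq_maxr _ _)).
rewrite [RHS]big_mkcondr; apply: eq_bigr => k _.
by case: ltnP => // /f0.
Qed.

(** With [p = j + k] this is [alternating_bin_bin] for [N = n - j] and [M = j.+1]. It collects the
    coefficient of [E j] over all [F E p]. *)
Lemma sum_F_weights (K : comNzRingType) (n j c : nat) :
  (j <= n)%N ->
  \sum_(p < n.+1 | (j <= p)%N) (-1) ^+ p * 'C(n - j, n - p)%:R * 'C(p.+1, c)%:R =
  if (c <= n.+1)%N then (-1) ^+ n * 'C(j.+1, n.+1 - c)%:R else 0 :> K.
Proof.
move=> le_j.
rewrite -(@sum_ord_shift _ (fun p => (-1) ^+ p * 'C(n - j, n - p)%:R *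
  'C(p.+1, c)%:R) n.+1 j (n - j).+1); [|lia|lia].
have := alternating_bin_bin K (n - j) j.+1 c.
have -> : (j.+1 + (n - j))%N = n.+1 by lia.
move=> /(congr1 (fun x => (-1) ^+ j * x)); rewrite mulr_sumr => binE.
transitivity (\sum_(k < (n - j).+1)
   (-1) ^+ j * ((-1) ^+ k * 'C(n - j, k)%:R * 'C(j.+1 + k, c)%:R : K)).
  apply: eq_bigr => k _; have le_k : (k <= n - j)%N by rewrite -ltnS ltn_ord.
  by rewrite exprD addSn -(bin_sub le_k) -subnDA !mulrA.
rewrite binE; case: ifP => _; last by rewrite mulr0.
by rewrite mulrA -exprD subnKC.
Qed.

(** * Double sums as halves of finite differences *)

Section WeightedSums.
Variables (R : realType) (n : nat) (E : 'I_n.+1 -> {poly R[i]}).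

(** The ranges are independent of [a] and [p], as the extra terms vanish through [i] or the
    binomial; [+ i] in the sign avoids truncated subtraction. *)
Definition weighted_sum (a : nat) : R[i] :=
  \sum_(p < n.+1) \sum_(i < n.+2) (-1) ^+ (p + a + i) * 'C(p.+1, a + i)%:R
    * i%:R * ((E p).[- i%:R] + (F E p).[i%:R]).

(* Summed over [k <= j+1], the [(j+1)]-th difference of [- 'X * E j] at [c]. *)
Definition difference_term (c : nat) (j : 'I_n.+1) (k : nat) : R[i] :=
  (-1) ^+ k * 'C(j.+1, k)%:R * (k%:R - c%:R) * (E j).[c%:R - k%:R].

Lemma difference_term_eq0 c (j : 'I_n.+1) k : (j.+2 <= k)%N -> difference_term c j k = 0.
Proof. by move=> lt_k; rewrite /difference_term bin_small // mulr0 !mul0r. Qed.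

(* [a < k] would do in the first sum, as its [k = a] term vanishes; [a <= k]
   makes it complementary to the second sum when [a = b]. *)
Lemma weighted_sumE (a b : nat) : (a + b = n.+1)%N ->
  weighted_sum a = \sum_(j < n.+1) (-1) ^+ j *
    (\sum_(k < j.+2 | (a <= k)%N) difference_term a j k +
     \sum_(k < j.+2 | (k < b)%N) difference_term b j k).
Proof.
move=> abE; rewrite /weighted_sum.
under eq_bigr => p _ do (under eq_bigr => i _ do rewrite mulrDr; rewrite big_split /=).
rewrite big_split /=; under [RHS]eq_bigr => j _ do rewrite mulrDr.
rewrite big_split /=; congr (_ + _).
  (* The values at [- i]: substitute [k = a + i]. *)
  apply: eq_bigr => j _; have lt_j := ltn_ord j.
  rewrite -(@sum_ord_shift _ (difference_term a j) j.+2 a n.+2); first last.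
  - by move=> k /andP[lt_k _]; exact: difference_term_eq0.
  - lia.
  rewrite mulr_sumr; apply: eq_bigr => i _.
  rewrite /difference_term natrD -addnA exprD.
  have -> : a%:R - (a%:R + i%:R) = - i%:R :> R[i] by ring.
  by ring.
transitivity (\sum_(j < n.+1) \sum_(i < n.+2)
    (-1) ^+ (j + a + i) * i%:R * (E j).[i%:R] *
    \sum_(p < n.+1 | (j <= p)%N)
      (-1) ^+ p * 'C(n - j, n - p)%:R * 'C(p.+1, a + i)%:R).
  rewrite exchange_big [RHS]exchange_big /=; apply: eq_bigr => i _.
  under [RHS]eq_bigr => j _ do rewrite mulr_sumr.
  rewrite (exchange_big_dep xpredT) //=; apply: eq_bigr => p _.
  rewrite /F horner_sum mulr_sumr; apply: eq_bigr => j _.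
  by rewrite hornerZ -!addnA !exprD; ring.
apply: eq_bigr => j _; have lt_j := ltn_ord j.
(* The values at [i]: substitute [k = b - i]. The term [k = b] is zero and gets dropped at the
   end. *)
transitivity ((-1) ^+ j * \sum_(k < j.+2 | (k <= b)%N) difference_term b j k).
  rewrite -(@sum_ord_reflect _ (difference_term b j) j.+2 b n.+2); first last.
  - by move=> k; exact: difference_term_eq0.
  - lia.
  rewrite mulr_sumr; apply: eq_bigr => i _; rewrite sum_F_weights; last by lia.
  have -> : (a + i <= n.+1)%N = (i <= b)%N by lia.
  case: leqP => [le_i|_]; last by rewrite !mulr0.
  rewrite /difference_term natrB //.
  have -> : (n.+1 - (a + i) = b - i)%N by lia.
  have -> : b%:R - (b%:R - i%:R) = i%:R :> R[i] by ring.
  (* Since [a + b = n.+1], the two exponents differ in parity; the extra sign matches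
     [k - b = - i]. *)
  have signE : (-1) ^+ (a + i) * (-1) ^+ n = - (-1) ^+ (b - i) :> R[i].
    rewrite -exprD -[RHS]mulN1r -exprS -signr_odd -[RHS]signr_odd.
    congr (_ ^+ nat_of_bool _).
    lia.
  transitivity ((-1) ^+ j * ((-1) ^+ (a + i) * (-1) ^+ n) * i%:R *
     (E j).[i%:R] * 'C(j.+1, b - i)%:R).
    by rewrite -addnA exprD; ring.
  by rewrite signE; ring.
congr (_ * _); rewrite big_mkcond [RHS]big_mkcond; apply: eq_bigr => k _.
by case: ltngtP => // ->; rewrite /difference_term subrr mulr0 mul0r.
Qed.

(** The factor [k - c] is [- 'X] at the node [c - k], and (j+1)!/j! leaves [j.+1]. The value does
    not depend on [c], so any centre may be used for gluing. *)
Lemma sum_difference_term (v : 'I_n.+1 -> R[i]) (c : nat) (j : 'I_n.+1) :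
  (size (E j) <= j.+1)%N -> (E j)`_j = v j / j`!%:R ->
  \sum_(k < j.+2) difference_term c j k = - (j.+1%:R * v j).
Proof.
move=> sE leadE; transitivity (\sum_(k < j.+2)
   (-1) ^+ k * 'C(j.+1, k)%:R * (- (E j * 'X)).[c%:R - k%:R]).
  by apply: eq_bigr => k _; rewrite hornerN hornerMX /difference_term; ring.
rewrite alternating_bin_horner; last first.
  rewrite size_polyN; have [->|E_neq0] := eqVneq (E j) 0; first by rewrite mul0r size_poly0.
  by rewrite size_mulX.
rewrite coefN coefMX /= leadE factS natrM mulrN -mulrA; congr (- (_ * _)).
by rewrite mulrC divfK // Num.Theory.pnatr_eq0 -lt0n fact_gt0.
Qed.

End WeightedSums.

(** * Matching the sums of the theorem *)

Lemma sum_widen_range (V : nmodType) (n m : nat) (h : 'I_n.+1 -> nat -> V) :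
  (forall p, h p 0%N = 0) ->
  (forall (p : 'I_n.+1) i, (p.+1 < m + i)%N -> h p i = 0) ->
  \sum_(p < n.+1 | (m <= p)%N) \sum_(1 <= i < (p.+1 - m).+1) h p i =
  \sum_(p < n.+1) \sum_(i < n.+2) h p i.
Proof.
move=> h0 h_small; rewrite big_mkcond; apply: eq_bigr => p _.
have lt_p := ltn_ord p.
rewrite big_ord_recl h0 add0r.
case: leqP => [le_m|lt_m]; last first.
  by rewrite big1 // => i _; rewrite h_small // lift0; lia.
rewrite big_add1 big_mkord (big_ord_widen n.+1 (fun i => h p i.+1)); last by lia.
rewrite big_mkcond; apply: eq_bigr => i _.
by case: ltnP => // le_i; rewrite h_small // lift0; lia.
Qed.

Lemma signr_sub_add (K : comNzRingType) (s i : nat) :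
  (i <= s)%N -> (-1) ^+ (s - i) = (-1) ^+ (s + i) :> K.
Proof. by move=> le_i; rewrite -[LHS]signr_odd oddB // -oddD signr_odd. Qed.

Theorem theorem2p2 (R : realType) (n : nat)
    (E : 'I_n.+1 -> {poly R[i]}) (v : 'I_n.+1 -> R[i])
    (degE : forall j : 'I_n.+1, (size (E j) <= j.+1)%N)
    (leadE : forall j : 'I_n.+1,
       exists2 q : {poly R[i]}, (size q <= j)%N &
         E j = (v j / j`!%:R) *: 'X^j + q) :
  (forall m : nat, odd n -> m = (n.+1 %/ 2)%N ->
     cE v =
     \sum_(p < n.+1 | (m <= p)%N) \sum_(1 <= i < (p.+1 - m).+1)
        (-1) ^+ (p + m - i) * 'C(p.+1, m + i)%:R * i%:R
        * ((E p).[- i%:R] + (F E p).[i%:R]))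
  /\
  (forall m : nat, ~~ odd n -> m = (n %/ 2)%N ->
     cE v =
     \sum_(p < n.+1 | (m <= p)%N) \sum_(1 <= i < (p.+1 - m).+1)
        (-1) ^+ (p + 1 + m - i)
        * ('C(p.+1, m + i)%:R - 'C(p.+1, m + i + 1)%:R) * (i%:R / 2%:R)
        * ((E p).[- i%:R] + (F E p).[i%:R])).
Proof.
have diffE c (j : 'I_n.+1) : \sum_(k < j.+2) difference_term E c j k = - (j.+1%:R * v j).
  apply: sum_difference_term => //; have [q sq ->] := leadE j.
  by rewrite coefD coefZ coefXn eqxx mulr1 [q`_j]nth_default ?addr0.
have splitE c (j : 'I_n.+1) : \sum_(k < j.+2 | (c <= k)%N) difference_term E c j k +
    \sum_(k < j.+2 | (k < c)%N) difference_term E c j k = - (j.+1%:R * v j).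
  rewrite -(diffE c) [RHS](bigID (fun k : 'I__ => c <= k)%N) /=; congr (_ + _).
  by apply: eq_bigl => k; rewrite ltnNge.
split=> m n_odd mE.
  rewrite sum_widen_range; first last.
  - by move=> p i lt_p; rewrite bin_small // mulr0 !mul0r.
  - by move=> p; rewrite mulr0 mul0r.
  have -> : cE v = weighted_sum E m.
    (* Here [n.+1 = m + m], so both halves have centre [m]. *)
    rewrite (@weighted_sumE _ _ _ m m); last by lia.
    apply: eq_bigr => p _; rewrite splitE; have lt_p := ltn_ord p.
    have -> : (-1) ^+ (n - p) = - (-1) ^+ p :> R[i].
      rewrite -[RHS]mulN1r -exprS -signr_odd -[RHS]signr_odd.
      by congr (_ ^+ nat_of_bool _); lia.
    by ring.
  apply: eq_bigr => p _; apply: eq_bigr => i _.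
  (* Where the exponent [p + m - i] truncates, the binomial is zero. *)
  have [le_i|lt_i] := leqP i (p + m); first by rewrite signr_sub_add.
  by rewrite bin_small ?mulr0 ?mul0r //; lia.
rewrite sum_widen_range; first last.
- by move=> p i lt_p; rewrite !bin_small ?subrr ?mulr0 ?mul0r //; lia.
- by move=> p; rewrite mul0r mulr0 mul0r.
have two_neq0 : 2%:R != 0 :> R[i] by rewrite Num.Theory.pnatr_eq0.
(* Raising [m] to [m.+1] flips the sign, so both binomials contribute with the same sign. *)
transitivity (- (weighted_sum E m + weighted_sum E m.+1) / 2%:R).
  apply: (mulIf two_neq0); rewrite divfK //.
  rewrite (@weighted_sumE _ _ _ m m.+1); last by lia.
  rewrite (@weighted_sumE _ _ _ m.+1 m); last by lia.
  rewrite -big_split /= -sumrN mulr_suml; apply: eq_bigr => p _.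
  have lt_p := ltn_ord p.
  (* Each weighted sum has one half with centre [m] and one with centre [m.+1]; regroup by
     centre. *)
  transitivity (- ((-1) ^+ p *
    ((\sum_(k < p.+2 | (m <= k)%N) difference_term E m p k +
      \sum_(k < p.+2 | (k < m)%N) difference_term E m p k) +
     (\sum_(k < p.+2 | (m.+1 <= k)%N) difference_term E m.+1 p k +
      \sum_(k < p.+2 | (k < m.+1)%N) difference_term E m.+1 p k)))); last by ring.
  rewrite !splitE.
  have -> : (-1) ^+ (n - p) = (-1) ^+ p :> R[i].
    by rewrite -signr_odd -[RHS]signr_odd; congr (_ ^+ nat_of_bool _); lia.
  by ring.
rewrite /weighted_sum -big_split -sumrN mulr_suml; apply: eq_bigr => p _.
rewrite -big_split -sumrN mulr_suml; apply: eq_bigr => i _ /=.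
have [le_i|lt_i] := leqP i (p + 1 + m); last first.
  by rewrite !bin_small ?subrr ?mulr0 ?mul0r ?addr0 ?oppr0 ?mul0r //; lia.
rewrite signr_sub_add // addn1 addnS addSn addn1 addSn !exprS.
by ring.
Qed.
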